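(* Let $n,m\ge 1$ be integers and $\mu>0$. Let $p$ be an admissible weight on $\mathbb{C}^n$ and let $D_p=\{(z,\zeta)\in\mathbb{C}^n\times\mathbb{C}^m:\ \|\zeta\|^2<p(z)\}$ be the associated Hartogs domain. For $v\in\mathbb{C}^n$ put $\varphi_v(z,\zeta)=\bigl(z-v,\ e^{\mu\langle z,v\rangle-\frac{\mu}{2}\|v\|^2}\zeta\bigr)$. Then $\varphi_v$ (restricted to $D_p$) is an automorphism of $D_p$ for every $v\in\mathbb{C}^n$ if and only if there is a constant $c>0$ such that $p(z)=c\,e^{-\mu\|z\|^2}$ for all $z\in\mathbb{C}^n$. That is, up to a constant multiple of $p$, the Fock-Bargmann-Hartogs domain $D_{n,m}=\{(z,\zeta)\in\mathbb{C}^n\times\mathbb{C}^m:\ \|\zeta\|^2<e^{-\mu\|z\|^2}\}$ is the unique Hartogs domain $D_p$ having all the maps $\varphi_v$ as automorphisms.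
   Context: $\langle z,w\rangle=\sum_j z_j\overline{w_j}$ and $\|z\|^2=\langle z,z\rangle$. For a domain (connected open set) $\Omega\subset\mathbb{C}^N$, $\mathrm{Aut}(\Omega)$ is the group of biholomorphic self-maps of $\Omega$; its elements are called automorphisms. Let $D\subset\mathbb{C}^n$ be a domain and $p$ a positive measurable function on $D$ (a weight). The weighted Bergman space is $A^2(D,p)=\{f \text{ holomorphic on } D:\ \int_D|f|^2\,p\,dV<\infty\}$, where $dV$ is Lebesgue measure, with inner product $\langle f,g\rangle=\int_D f\overline{g}\,p\,dV$. The weight $p$ is admissible if $A^2(D,p)$ is a closed subspace of $L^2(D,p)$ and, for every $z\in D$, the evaluation functional $f\mapsto f(z)$ is bounded on $A^2(D,p)$. Standing assumptions: all weights considered (in particular $p$ and $p^m$) are admissible; $D_p$ is a domain; the unweighted Bergman space $A^2(D_p)=A^2(D_p,1)$ is a reproducing kernel Hilbert space. *)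

(* Defs.v *)
From HB Require Import structures.
From mathcomp Require Import all_boot all_order all_algebra.
From mathcomp Require Import complex.
From mathcomp Require Import all_classical all_reals all_analysis.

Set Implicit Arguments.
Unset Strict Implicit.
Unset Printing Implicit Defensive.

Import Order.TTheory GRing.Theory Num.Theory.
Import numFieldNormedType.Exports.
Local Open Scope classical_set_scope.
Local Open Scope ring_scope.
Local Open Scope complex_scope.

(* [R[i]] carries the norm topology of the numFieldType [R[i]]; the generic
   instances are keyed on abstract structures and do not apply to the concrete
   type constructor [complex]. *)
HB.instance Definition _ (R : realType) :=
  PseudoPointedMetric.copy R[i] R[i]^o.
HB.instance Definition _ (R : realType) :=
  NormedModule.copy R[i] R[i]^o.

Section complex_space.
Variable R : realType.
Local Notation C := R[i].

Definition cabs (x : C) : R := ComplexField.Normc.normc x.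

Definition cexp (x : C) : C :=
  (expR (complex.Re x))%:C * (cos (complex.Im x) +i* sin (complex.Im x)).

Definition hdot (N : nat) (z w : 'rV[C]_N) : C :=
  \sum_(j < N) z 0 j * (w 0 j)^*.

(* <z, z> is real; this is ||z||^2, not to be confused with the sup norm `|z|
   of row vectors, which is only used for the topology. *)
Definition hnormsq (N : nat) (z : 'rV[C]_N) : R := complex.Re (hdot z z).

Definition is_domain (N : nat) (D : set 'rV[C]_N) : Prop :=
  open D /\ connected D.

(* [differentiable] is Frechet differentiability over the field of scalars of
   the normed modules, here the complex numbers. *)
Definition holomorphic_on (V W : normedModType C) (D : set V) (f : V -> W) :=
  forall z, D z -> differentiable f z.

Definition automorphism (V : normedModType C) (D : set V) (f : V -> V) :=
  exists g : V -> V,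
    [/\ {homo f : z / D z}, {homo g : z / D z},
        {in D, cancel f g}, {in D, cancel g f} &
        holomorphic_on D f /\ holomorphic_on D g].

End complex_space.

(* Lebesgue measure on C^N = R^(2N): Caratheodory's construction applied to the
   infimum of the total volume of countable covers by open boxes. *)
Section lebesgue_complex_space.
Variables (R : realType) (N : nat).
Local Notation C := R[i].
Local Notation Re := (@complex.Re R).
Local Notation Im := (@complex.Im R).

(* [None] is the empty box: for N = 0 no pair of corners represents it. *)
Definition cbox : Type := option ('rV[C]_N * 'rV[C]_N).

Definition cbox_set (b : cbox) : set 'rV[C]_N :=
  if b is Some (l, u) then
    [set z | forall j, Re (l 0 j) < Re (z 0 j) < Re (u 0 j) /\
                       Im (l 0 j) < Im (z 0 j) < Im (u 0 j)]
  else set0.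

Definition cbox_vol (b : cbox) : \bar R :=
  if b is Some (l, u) then
    (\prod_(j < N) (Num.max 0 (Re (u 0 j) - Re (l 0 j)) *
                    Num.max 0 (Im (u 0 j) - Im (l 0 j))))%:E
  else 0%E.

Definition cbox_cover (X : set 'rV[C]_N) : set (nat -> cbox) :=
  [set B | X `<=` \bigcup_k cbox_set (B k)].

Definition lebesgue_outer (X : set 'rV[C]_N) : \bar R :=
  ereal_inf [set (\sum_(k <oo) cbox_vol (B k))%E | B in cbox_cover X].

Let cbox_vol_ge0 b : (0 <= cbox_vol b)%E.
Proof.
case: b => [[l u]|//]; rewrite lee_fin; apply: prodr_ge0 => j _.
by rewrite mulr_ge0// le_max lexx.
Qed.

Let lebesgue_outer_ge0 X : (0 <= lebesgue_outer X)%E.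
Proof.
by apply: le_ereal_inf_tmp => _ [B _ <-]; exact: nneseries_ge0.
Qed.

Let lebesgue_outer0 : lebesgue_outer set0 = 0%E.
Proof.
apply/eqP; rewrite eq_le lebesgue_outer_ge0 andbT.
apply: ereal_inf_lbound; exists (fun=> None) => //.
by rewrite eseries0.
Qed.

Let le_lebesgue_outer : {homo lebesgue_outer : A B / A `<=` B >-> (A <= B)%E}.
Proof.
move=> A B AB; apply/ereal_inf_le_tmp => _ [F FB <-].
by exists F => //; exact: subset_trans AB FB.
Qed.

Let lebesgue_outer_sigma_subadditive : sigma_subadditive lebesgue_outer.
Proof.
move=> A; have [[i ioo]|] := pselect (exists i, lebesgue_outer (A i) = +oo%E).
  by rewrite (eseries_pinfty _ _ ioo) ?leey// => n _; rewrite -ltNye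
    (lt_le_trans _ (lebesgue_outer_ge0 _)).
rewrite -forallNE => Aoo.
suff add2e (e : {posnum R}) : (lebesgue_outer (\bigcup_n A n) <=
    \sum_(i <oo) lebesgue_outer (A i) + e%:num%:E)%E.
  by apply/lee_addgt0Pr => _/posnumP[].
rewrite (le_trans _ (epsilon_trick _ _ _))//.
pose P n (B : nat -> cbox) := cbox_cover (A n) B /\
  (\sum_(k <oo) cbox_vol (B k) <=
   lebesgue_outer (A n) + (e%:num / (2 ^ n.+1)%:R)%:E)%E.
have [G PG] : {G : nat -> nat -> cbox & forall n, P n (G n)}.
  apply: (@choice _ _ P) => n; rewrite /P.
  have en1 : (0 < e%:num / (2 ^ n.+1)%:R :> R)%R by [].
  have fin : lebesgue_outer (A n) \is a fin_num.
    by rewrite ge0_fin_numE// ltey; exact/eqP/Aoo.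
  have [_ [B AB <-] Blt] := lb_ereal_inf_adherent en1 fin.
  by exists B; split => //; exact: ltW.
pose g (x : nat * nat) := cbox_vol (G x.1 x.2).
apply: (@le_trans _ _ (\esum_(x in setT) g x)%E).
  have /card_esym/ppcard_eqP[f] := card_nat2.
  apply: ereal_inf_lbound; exists (fun k => G (f k).1 (f k).2).
    move=> t [i _ Ait]; have [j _ Gt] := (PG i).1 t Ait.
    by exists (f^-1%FUN (i, j)) => //=; rewrite invK ?inE.
  rewrite nneseries_esumT; last by move=> n; exact: cbox_vol_ge0.
  by rewrite (reindex_esum setT setT f).
suff -> : (\esum_(x in setT) g x =
    \sum_(i <oo) \sum_(j <oo) cbox_vol (G i j))%E.
  apply: lee_nneseries => [n _ _|n _]; first exact: nneseries_ge0.
  exact: (PG n).2.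
rewrite nneseries_esumT; last by move=> n; exact: nneseries_ge0.
rewrite (eq_esum (b := fun i => \esum_(j in setT) g (i, j))%E); last first.
  by move=> i _; rewrite nneseries_esumT// => j; exact: cbox_vol_ge0.
rewrite esum_esum; last by move=> i j _ _; exact: cbox_vol_ge0.
rewrite (_ : [set: nat] `*`` _ = setT); first by apply: eq_esum => -[].
by apply/seteqP; split => // -[].
Qed.

HB.instance Definition _ := isOuterMeasure.Build R 'rV[C]_N lebesgue_outer
  lebesgue_outer0 lebesgue_outer_ge0 le_lebesgue_outer
  lebesgue_outer_sigma_subadditive.

Definition lebesgue_outer_measure : {outer_measure set 'rV[C]_N -> \bar R} :=
  lebesgue_outer.

Definition lebesgue_space := caratheodory_type lebesgue_outer_measure.

HB.instance Definition _ := Measurable.on lebesgue_space.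

Definition lebesgue_cmeasure : {measure set lebesgue_space -> \bar R} :=
  (lebesgue_outer_measure :
    set (caratheodory_type lebesgue_outer_measure) -> \bar R).

End lebesgue_complex_space.

Section weighted_bergman_space.
Variables (R : realType) (N : nat).
Local Notation C := R[i].
Local Notation T := (lebesgue_space R N).
Local Notation dV := (lebesgue_cmeasure R N).
Implicit Types (D : set 'rV[C]_N) (p : 'rV[C]_N -> R) (f g h : 'rV[C]_N -> C).

Definition weight D p : Prop :=
  measurable_fun (D : set T) (p : T -> R) /\ (forall z, D z -> 0 < p z).

Definition wintegral D p f : \bar R :=
  (\int[dV]_(z in (D : set T)) (cabs (f z) ^+ 2 * p z)%:E)%E.

Definition L2space D p : set ('rV[C]_N -> C) :=
  [set f | [/\ measurable_fun (D : set T) (fun z : T => complex.Re (f z)),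
               measurable_fun (D : set T) (fun z : T => complex.Im (f z)) &
               (wintegral D p f < +oo)%E]].

(* Only meaningful on [L2space D p], since [fine +oo = 0]. *)
Definition L2norm D p f : R := Num.sqrt (fine (wintegral D p f)).

(* Functions are total; only their restriction to [D] matters. *)
Definition bergman_space D p : set ('rV[C]_N -> C) :=
  [set f | holomorphic_on D f /\ (wintegral D p f < +oo)%E].

(* [bergman_space D p] is closed in L^2(D, p), whose elements are classes of
   functions modulo equality almost everywhere. *)
Definition bergman_closed D p : Prop :=
  forall (f_ : nat -> 'rV[C]_N -> C) g,
    (forall k, bergman_space D p (f_ k)) -> L2space D p g ->
    (fun k => L2norm D p (f_ k - g)) @ \oo --> (0 : R) ->
    exists2 h, bergman_space D p h &
      {ae dV, forall z : T, (D : set T) z -> h z = g z}.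

Definition bounded_evaluations D p : Prop :=
  forall z, D z -> exists M : R,
    forall f, bergman_space D p f -> cabs (f z) <= M * L2norm D p f.

Definition admissible D p : Prop :=
  [/\ weight D p, bergman_closed D p & bounded_evaluations D p].

Definition bergman_complete D p : Prop :=
  forall f_ : nat -> 'rV[C]_N -> C,
    (forall k, bergman_space D p (f_ k)) ->
    (forall e : R, 0 < e -> exists K : nat, forall k l : nat,
       (K <= k)%N -> (K <= l)%N -> L2norm D p (f_ k - f_ l) < e) ->
    exists2 h, bergman_space D p h &
      (fun k => L2norm D p (f_ k - h)) @ \oo --> (0 : R).

(* [L2norm] is induced by the inner product of A^2(D, p), so completeness makes
   it a Hilbert space. *)
Definition is_RKHS D p : Prop :=
  bergman_complete D p /\ bounded_evaluations D p.

End weighted_bergman_space.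

Section hartogs_domains.
Variables (R : realType) (n m : nat).
Local Notation C := R[i].

(* C^n x C^m is identified with C^(n+m): the point (z, zeta) is the row vector
   [row_mx z zeta], so z = [lsubmx x] and zeta = [rsubmx x]. *)
Definition hartogs (p : 'rV[C]_n -> R) : set 'rV[C]_(n + m) :=
  [set x | hnormsq (rsubmx x) < p (lsubmx x)].

Definition fock_weight (mu : R) (z : 'rV[C]_n) : R := expR (- mu * hnormsq z).

Definition fock_bargmann_hartogs (mu : R) : set 'rV[C]_(n + m) :=
  hartogs (fock_weight mu).

Definition phi (mu : R) (v : 'rV[C]_n) (x : 'rV[C]_(n + m)) :
    'rV[C]_(n + m) :=
  row_mx (lsubmx x - v)
    (cexp (mu%:C * hdot (lsubmx x) v - (mu / 2 * hnormsq v)%:C) *: rsubmx x).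

End hartogs_domains.

Arguments hartogs {R n} m p.
Arguments fock_bargmann_hartogs {R} n m mu.
Arguments phi {R n m} mu v x.

(* Main.v *)
Require Import Defs.
From mathcomp Require Import all_boot all_order all_algebra.
From mathcomp Require Import complex.
From mathcomp Require Import all_classical all_reals all_analysis.
From mathcomp Require Import ring lra.
Import Order.TTheory GRing.Theory Num.Theory.
Import numFieldNormedType.Exports.
Local Open Scope classical_set_scope.
Local Open Scope ring_scope.

(** The theorem rests on one computation.  The scalar by which phi_v multiplies
    zeta has squared modulus
      E(z, v) = exp (2 mu Re <z, v> - mu ||v||^2),
    so phi_v maps D_p into itself exactly when E(z, v) p(z) <= p(z - v) for
    all z: the fibre of D_p over z is the ball of squared radius p(z), and
    phi_v maps it onto the ball of squared radius E(z, v) p(z) over z - v.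

    If every phi_v preserves D_p, two instances of this inequality determine p.
    The choice v = z gives exp (mu ||z||^2) p(z) <= p(0), and the point 0 with
    v = - z gives exp (- mu ||z||^2) p(0) <= p(z); hence
    p(z) = p(0) exp (- mu ||z||^2) ([weight_gaussian]).

    Conversely, expanding ||z - v||^2 shows that for p = c exp (- mu ||.||^2)
    the inequality is an equality ([phi_hartogs_gaussian]), and phi_(-v) is
    inverse to phi_v ([phiK]).  It remains to see that phi_v is complex
    differentiable ([differentiable_phi]), which reduces to the complex
    exponential.  That function is given by its real and imaginary parts, so its
    derivative is obtained from the quadratic estimate
    |exp x - 1 - x| <= 6 |x|^2 near 0 ([cexp_dist_taylor1]), itself a
    consequence of elementary bounds on the real exponential, sine and cosine.

    The statement on D_{n,m} is the case c = 1, and the last equivalence follows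
    because a positive weight is determined by its Hartogs domain
    ([hartogs_inj]). *)

(** * Second-order bounds for real sine, cosine and exponential *)

(** A form of the mean value theorem for sine on the segment from 0 to [b] that
    does not depend on the sign of [b]; both bounds on sine below follow from
    it. *)
Lemma sin_mean_value {R : realType} (b : R) :
  exists2 c : R, `|c| <= `|b| & sin b = cos c * b.
Proof.
have cont a b' : {within `[a, b'], continuous (@sin R)}.
  by apply: continuous_subspaceT => x; exact: continuous_sin.
have [b0|b0] := leP 0 b.
  have [c cb] := MVT_segment b0 (fun x _ => is_derive_sin x) (cont _ _).
  rewrite sin0 !subr0 => ->; exists c => //.
  by move: cb; rewrite in_itv/= => /andP[c0 cb]; rewrite !ger0_norm.
have [c cb] := MVT_segment (ltW b0) (fun x _ => is_derive_sin x) (cont _ _).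
rewrite sin0 !sub0r => /eqP; rewrite mulrN eqr_opp => /eqP ->; exists c => //.
move: cb; rewrite in_itv/= => /andP[cb c0].
by rewrite !ler0_norm ?lerN2// ltW.
Qed.

Lemma normr_sin_le {R : realType} (b : R) : `|sin b| <= `|b|.
Proof.
have [c _ ->] := sin_mean_value b.
by rewrite normrM ler_piMl// cos_max.
Qed.

(** By the half-angle formula, 1 - cos b = 2 sin^2 (b / 2). *)
Lemma cos_dist1 {R : realType} (b : R) : `|cos b - 1| <= b ^+ 2 / 2.
Proof.
rewrite (_ : b = (b / 2) *+ 2); last by rewrite -mulr_natr divfK.
set t := b / 2.
have -> : cos (t *+ 2) - 1 = - (2 * sin t ^+ 2).
  by rewrite cos_mulr2n cos2sin2; ring.
rewrite normrN ger0_norm; last by apply: mulr_ge0 => //; exact: sqr_ge0.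
have : sin t ^+ 2 <= t ^+ 2.
  rewrite -(real_normK (num_real (sin t))) -(real_normK (num_real t)).
  by rewrite lerXn2r ?nnegrE ?normr_ge0 ?normr_sin_le.
move: (sin t) => s; lra.
Qed.

Lemma sin_dist_id {R : realType} (b : R) : `|sin b - b| <= `|b| ^+ 3 / 2.
Proof.
have [c cb ->] := sin_mean_value b.
rewrite -{2}(mul1r b) -mulrBl normrM exprSr mulrAC ler_wpM2r//.
rewrite (le_trans (cos_dist1 c))// ler_wpM2r//.
by rewrite -(real_normK (num_real c)) lerXn2r ?nnegrE ?normr_ge0.
Qed.

(** Both signs are controlled by 1 + t <= exp t: taken at a it shows that the remainder
    is nonnegative, and taken at - a it gives exp a <= 1 / (1 - a), which is at
    most 1 + a + 2 a^2 when a <= 1 / 2. *)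
Lemma expR_dist_taylor1 {R : realType} (a : R) : `|a| <= 1 / 2 ->
  `|expR a - 1 - a| <= 2 * a ^+ 2.
Proof.
rewrite ler_norml => /andP[a1 a2].
have l := expR_ge1Dx a; have := expR_ge1Dx (- a).
have e0 := expR_gt0 a.
have : expR a * expR (- a) = 1 by rewrite expRxMexpNx_1.
move: (expR a) (expR (- a)) l e0 => e f l e0 ef fa.
have ea : e * (1 - a) <= 1.
  by rewrite -[X in _ <= X]ef; exact: ler_wpM2l (ltW e0) _ _ fa.
rewrite ger0_norm; last by lra.
nra.
Qed.

(** * The complex exponential is holomorphic *)

Section complex_exponential.
Local Open Scope complex_scope.
Context {R : realType}.
Implicit Types x y : R[i].

Lemma cexpD x y : cexp (x + y) = cexp x * cexp y.
Proof.
case: x y => [a b] [c d]; rewrite /cexp /= expRD cosD sinD.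
by apply/eqP; rewrite eq_complex/=; apply/andP; split; apply/eqP; ring.
Qed.

Lemma cexp0 : cexp 0 = 1 :> R[i].
Proof.
by rewrite /cexp/= expR0 cos0 sin0; apply/eqP; rewrite eq_complex/=;
  apply/andP; split; apply/eqP; ring.
Qed.

(** A substitute for the power series, which gives at once that the derivative at 0 is 1.
    With x = a + i b the remainder has real part
    e^a (cos b - 1) + (e^a - 1 - a) and imaginary part
    e^a (sin b - b) + (e^a - 1) b, each bounded by 3 |x|^2. *)
Lemma cexp_dist_taylor1 (x : R[i]) : `|x| <= (1 / 2)%:C ->
  `|cexp x - 1 - x| <= 6%:R * `|x| ^+ 2.
Proof.
rewrite normc_def.
case: x => a b /=; set r := Num.sqrt _; rewrite lecR => r2.
have r0 : 0 <= r by exact: sqrtr_ge0.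
have rE : r ^+ 2 = a ^+ 2 + b ^+ 2 by rewrite sqr_sqrtr// addr_ge0// sqr_ge0.
have ar : `|a| <= r.
  by rewrite -ler_sqr ?nnegrE// real_normK ?num_real// rE lerDl sqr_ge0.
have br : `|b| <= r.
  by rewrite -ler_sqr ?nnegrE// real_normK ?num_real// rE lerDr sqr_ge0.
have := expR_dist_taylor1 a (le_trans ar r2).
have := cos_dist1 b; have := sin_dist_id b.
have := expR_gt0 a.
rewrite /cexp/=.
set e := expR a; set c := cos b; set s := sin b => e0 sb cb ea.
have e2 : e <= 2.
  by move: ea ar; rewrite !ler_norml => /andP[_ ?] /andP[? ?]; nra.
have -> : e%:C * (c +i* s) - 1 - (a +i* b) =
  (e * (c - 1) + (e - 1 - a)) +i* (e * (s - b) + ((e - 1 - a) + a) * b).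
  by apply/eqP; rewrite eq_complex/=; apply/andP; split; apply/eqP; ring.
set u := _ + _; set v := (X in _ +i* X).
have ur : `|u| <= 3 * r ^+ 2.
  rewrite /u (le_trans (ler_normD _ _))// normrM (ger0_norm (ltW e0)).
  have : e * `|c - 1| <= 2 * (b ^+ 2 / 2) by rewrite ler_pM// ltW.
  by have := sqr_ge0 b; have := sqr_ge0 a; move: ea rE; lra.
have vr : `|v| <= 3 * r ^+ 2.
  rewrite /v (le_trans (ler_normD _ _))// !normrM (ger0_norm (ltW e0)).
  have : e * `|s - b| <= 2 * (`|b| ^+ 3 / 2) by rewrite ler_pM// ltW.
  have : `|e - 1 - a + a| * `|b| <= (2 * `|a|) * `|b|.
    rewrite ler_wpM2r// (le_trans (ler_normD _ _))//.
    move: ea; rewrite -(real_normK (num_real a)).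
    by have := normr_ge0 a; nra.
  have := normr_ge0 a; have := normr_ge0 b.
  move: ar br r2 r0; clear; move: `|a| `|b| => A B; nra.
have -> : u +i* v = u%:C + v%:C * 'i.
  by apply/eqP; rewrite eq_complex/=; apply/andP; split; apply/eqP; ring.
rewrite (le_trans (ler_normD _ _))//.
rewrite normrM !normc_def/= !expr0n/= !addr0 !sqrtr_sqr add0r expr1n sqrtr1.
rewrite mulr1 -rmorphXn/= -(rmorphD (real_complex R)) -(rmorph_nat (real_complex R)).
by rewrite -rmorphM/= lecR; move: ur vr; lra.
Qed.

(** By the addition formula, the difference quotient at x differs from exp x by
    exp x times the remainder at 0 divided by h, hence by O(|h|). *)
Lemma derivable_cexp x : derivable (@cexp R) x 1.
Proof.
apply/cvg_ex; exists (cexp x).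
apply/cvgrPdist_le => /= e e0.
(* A positive bound for |exp x|, so that it can be divided by. *)
have [M M0 cM] : exists2 M : R[i], 0 < M & `|cexp x| <= M.
  exists (`|cexp x| + 1); last by rewrite lerDl.
  by rewrite ltr_pwDr.
near=> h.
have h0 : h != 0 by near: h; exact: nbhs_dnbhs_neq.
have h1 : `|h| <= (1 / 2)%:C.
  near: h; apply: nbhs_dnbhs; apply: nbhs0_le; by rewrite ltcR divr_gt0.
have h2 : `|h| <= e / (6 * M).
  near: h; apply: nbhs_dnbhs; apply: nbhs0_le; by rewrite divr_gt0// mulr_gt0.
rewrite /= [h *: _]mulr1 cexpD.
have -> : h^-1 *: (cexp h * cexp x - cexp x)
  = cexp x + cexp x * (h^-1 * (cexp h - 1 - h)).
  change (h^-1 * (cexp h * cexp x - cexp x) =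
    cexp x + cexp x * (h^-1 * (cexp h - 1 - h))).
  by field.
rewrite opprD addrA subrr sub0r normrN normrM [X in _ * X]normrM normfV.
have hp : 0 < `|h| by rewrite normr_gt0.
have : `|h|^-1 * `|cexp h - 1 - h| <= 6 * `|h|.
  by rewrite mulrC ler_pdivrMr// -mulrA -expr2 cexp_dist_taylor1.
move=> H; apply: (@le_trans _ _ (M * (6 * `|h|))).
  by apply: ler_pM => //; rewrite mulr_ge0 // invr_ge0.
by rewrite mulrCA mulrA mulrC -ler_pdivlMr// mulr_gt0.
Unshelve. all: by end_near. Qed.

Lemma differentiable_cexp x : differentiable (@cexp R) x.
Proof. by apply/derivable1_diffP; exact: derivable_cexp. Qed.

End complex_exponential.

(** * The hermitian product *)

Section hermitian.
Local Open Scope complex_scope.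
Context {R : realType} {N : nat}.
Implicit Types (z w v : 'rV[R[i]]_N) (k : R[i]).

Lemma hdotBl z w v : hdot (z - w) v = hdot z v - hdot w v.
Proof.
rewrite /hdot -sumrB; apply: eq_bigr => j _.
by rewrite !mxE mulrBl.
Qed.

Lemma hdotNr z v : hdot z (- v) = - hdot z v.
Proof.
by rewrite /hdot -sumrN; apply: eq_bigr => j _; rewrite mxE rmorphN mulrN.
Qed.

Lemma hdotC z w : hdot w z = ((hdot z w)^*)%R.
Proof.
rewrite /hdot rmorph_sum; apply: eq_bigr => j _.
by rewrite rmorphM/= conjCK mulrC.
Qed.

Lemma hdotZ k z : hdot (k *: z) (k *: z) = `|k| ^+ 2 * hdot z z.
Proof.
rewrite /hdot mulr_sumr; apply: eq_bigr => j _.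
by rewrite !mxE rmorphM/= mulrACA sqr_normc.
Qed.

Lemma hnormsqN z : hnormsq (- z) = hnormsq z.
Proof. by rewrite -scaleN1r /hnormsq hdotZ normrN1 expr1n mul1r. Qed.

Lemma hnormsqB z v :
  hnormsq (z - v) = hnormsq z - 2 * complex.Re (hdot z v) + hnormsq v.
Proof.
rewrite /hnormsq hdotBl -[z - v]opprB hdotNr hdotNr [hdot z _]hdotC.
rewrite [hdot v _]hdotC !hdotBl [hdot v z]hdotC.
by case: (hdot z z) (hdot z v) (hdot v v) => [a b] [c d] [e f] /=; ring.
Qed.

Lemma hnormsq_cexpZ x z :
  hnormsq (cexp x *: z) = expR (2 * complex.Re x) * hnormsq z.
Proof.
rewrite /hnormsq hdotZ -add_Re2_Im2.
have -> : complex.Re (cexp x) ^+ 2 + complex.Im (cexp x) ^+ 2 =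
    expR (2 * complex.Re x).
  rewrite mulr_natl mulr2n expRD.
  case: x => a b /=; have := cos2Dsin2 b; move: (expR a) => e cs.
  by transitivity (e * e * (cos b ^+ 2 + sin b ^+ 2)); [ring|rewrite cs mulr1].
by case: (hdot z z) => a b /=; ring.
Qed.

(** The index [j] witnesses that the space is not zero. *)
Lemma hnormsq_onto (j : 'I_N) (t : R) : 0 <= t ->
  exists z : 'rV[R[i]]_N, hnormsq z = t.
Proof.
move=> t0; exists ((Num.sqrt t)%:C *: 'e_j).
rewrite /hnormsq hdotZ -add_Re2_Im2/= expr0n addr0 sqr_sqrtr//.
rewrite (_ : hdot 'e_j 'e_j = 1) /=; first by ring.
rewrite /hdot (bigD1 j)//= big1 => [|i ij].
  by rewrite !mxE !eqxx/= conjC1 mulr1 addr0.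
by rewrite !mxE (negbTE ij) andbF mul0r.
Qed.

End hermitian.

(** * The maps phi_v on Hartogs domains *)

Lemma differentiable_rV (K : numFieldType) (V : normedModType K) (n : nat)
    (f : V -> 'rV[K]_n) (a : V) :
  (forall j, differentiable (fun x => f x 0 j) a) -> differentiable f a.
Proof.
move=> df.
have -> : f = \sum_(j < n) (fun x => f x 0 j *: 'e_j).
  by apply/funext => x; rewrite fct_sumE -row_sum_delta.
by apply: differentiable_sum => j; exact: differentiableZl.
Qed.

Section fock_translations.
Local Open Scope complex_scope.
Context {R : realType} {n m : nat}.
Variable mu : R.
Implicit Types (v z : 'rV[R[i]]_n) (x : 'rV[R[i]]_(n + m)).

(** The exponents of phi_v at z and of phi_(-v) at z - v cancel, because
    <z - v, - v> = - <z, v> + ||v||^2. *)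
Lemma phiK v : cancel (phi mu v) (phi mu (- v) : 'rV[R[i]]_(n + m) -> _).
Proof.
move=> x; rewrite /phi row_mxKl row_mxKr opprK subrK scalerA -cexpD.
rewrite (_ : _ + _ = 0) ?cexp0 ?scale1r ?hsubmxK//.
rewrite hnormsqN hdotNr hdotBl /hnormsq.
have := hdotC v v.
case: (hdot _ v) (hdot v v) => [a b] [c d] [] dd.
have {dd} -> : d = 0 by lra.
by apply/eqP; rewrite eq_complex/=; apply/andP; split; apply/eqP; lra.
Qed.

Lemma hnormsq_rsubmx_phi v x :
  hnormsq (rsubmx (phi mu v x)) =
  expR (2 * mu * complex.Re (hdot (lsubmx x) v) - mu * hnormsq v) *
  hnormsq (rsubmx x).
Proof.
rewrite /phi row_mxKr hnormsq_cexpZ; congr (expR _ * _).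
by case: (hdot _ _) => a b /=; field.
Qed.

(** The product is linear in its first argument, the one that varies here; it is
    conjugate linear in the second. *)
Lemma differentiable_hdotl v x :
  differentiable (fun y : 'rV[R[i]]_(n + m) => hdot (lsubmx y) v) x.
Proof.
have -> : (fun y : 'rV[R[i]]_(n + m) => hdot (lsubmx y) v) =
    \sum_(j < n) (fun y : 'rV[R[i]]_(n + m) => ((v 0 j)^*)%R *: y 0 (lshift m j)).
  apply/funext => y; rewrite fct_sumE; apply: eq_bigr => j _.
  by rewrite mxE mulrC.
apply: differentiable_sum => j; apply: differentiableZ.
exact: differentiable_coord.
Qed.

Lemma differentiable_phi v x : differentiable (phi mu v) x.
Proof.
have dE : differentiable (fun y : 'rV[R[i]]_(n + m) =>
    cexp (mu%:C * hdot (lsubmx y) v - (mu / 2 * hnormsq v)%:C)) x.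
  apply: (@differentiable_comp _ _ _ _ (fun y : 'rV[R[i]]_(n + m) =>
     mu%:C * hdot (lsubmx y) v - (mu / 2 * hnormsq v)%:C) (@cexp R)).
    apply: differentiableB; last exact: differentiable_cst.
    apply: differentiableZ; exact: differentiable_hdotl.
  exact: differentiable_cexp.
apply: differentiable_rV => j; have [i ->|i ->] := split_ordP j.
  under eq_fun do rewrite row_mxEl !mxE.
  by apply: differentiableB => //; exact: differentiable_coord.
under eq_fun do rewrite row_mxEr !mxE.
apply: differentiableM => //; exact: differentiable_coord.
Qed.

(** Since phi_(-v) is the inverse of phi_v, invariance of [D] under the whole
    family is needed to send [D] into itself in both directions. *)
Lemma automorphism_phi (D : set 'rV[R[i]]_(n + m)) v :
    (forall w, {homo phi mu w : x / D x}) ->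
  automorphism D (phi mu v).
Proof.
move=> homoD; exists (phi mu (- v)); split => //.
- by move=> x _; exact: phiK.
- by move=> x _; rewrite -{1}(opprK v) phiK.
- by split=> x _; exact: differentiable_phi.
Qed.

(** ||z - v||^2 = ||z||^2 - 2 Re <z, v> + ||v||^2, so the factor by which the
    weight grows from z to z - v is exactly the squared modulus of the factor
    acting on zeta. *)
Lemma phi_hartogs_gaussian c v :
  {homo phi mu v : x /
    hartogs m (fun z => c * expR (- mu * hnormsq z)) x}.
Proof.
move=> x; rewrite /hartogs/= hnormsq_rsubmx_phi /phi row_mxKl hnormsqB.
set h := hdot _ _; set Z := hnormsq (lsubmx x); set E := _ - mu * _.
have -> : - mu * (Z - 2 * complex.Re h + hnormsq v) = E + - mu * Z.
  by rewrite /E; ring.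
by rewrite (expRD E) mulrCA ltr_pM2l// expR_gt0.
Qed.

(** Otherwise some point over z whose image has ||zeta||^2 equal to p (z - v)
    would lie in D_p, and its image would not; positivity of p (z - v) ensures
    that such a zeta exists. *)
Lemma phi_homo_weight_le (p : 'rV[R[i]]_n -> R) v z (j : 'I_m) :
  {homo phi mu v : x / hartogs m p x} -> 0 < p (z - v) ->
  expR (2 * mu * complex.Re (hdot z v) - mu * hnormsq v) * p z <= p (z - v).
Proof.
move=> homop; set E := expR _ => p0.
have E0 : 0 < E by exact: expR_gt0.
rewrite mulrC -ler_pdivlMr//; apply/negP => /negP; rewrite -ltNge => lt.
have [|zeta zetaE] := @hnormsq_onto R m j (p (z - v) / E).
  by rewrite divr_ge0// ltW.
have := homop (row_mx z zeta).
rewrite /hartogs/= hnormsq_rsubmx_phi /phi !row_mxKl row_mxKr zetaE.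
by rewrite -/E [E * _]mulrC divfK ?gt_eqF// ltxx => /(_ lt).
Qed.

Lemma weight_gaussian (p : 'rV[R[i]]_n -> R) (j : 'I_m) :
    (forall z, 0 < p z) ->
    (forall v, {homo phi mu v : x / hartogs m p x}) ->
  forall z, p z = p 0 * expR (- mu * hnormsq z).
Proof.
move=> p0 homop z; apply/eqP; rewrite eq_le; apply/andP; split.
  (* phi_z carries the fibre over z into the fibre over 0. *)
  have := phi_homo_weight_le p z z j (homop z) (p0 _).
  rewrite subrr -[complex.Re _]/(hnormsq z).
  rewrite (_ : _ - _ = - (- mu * hnormsq z)); last by ring.
  by rewrite expRN mulrC ler_pdivrMr ?expR_gt0.
(* phi_(-z) carries the fibre over 0 into the fibre over z. *)
have := phi_homo_weight_le p (- z) 0 j (homop (- z)) (p0 _).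
rewrite hdotNr sub0r opprK hnormsqN.
rewrite (_ : hdot 0 z = 0) /= ?oppr0 ?mulr0 ?sub0r -?mulNr 1?mulrC//.
by rewrite /hdot big1// => i _; rewrite mxE mul0r.
Qed.

(** A zeta with ||zeta||^2 = p2(z) is outside the fibre of p2 over z, hence
    outside that of any p1 whose domain is smaller. *)
Lemma hartogs_inj (p q : 'rV[R[i]]_n -> R) (j : 'I_m) :
    (forall z, 0 < p z) -> (forall z, 0 < q z) ->
  hartogs m p = hartogs m q -> p = q.
Proof.
have le (p1 p2 : 'rV[R[i]]_n -> R) z : 0 < p2 z ->
    hartogs m p1 `<=` hartogs m p2 -> p1 z <= p2 z.
  move=> p20 sub; rewrite leNgt; apply/negP => lt.
  have [zeta zetaE] := hnormsq_onto j _ (ltW p20).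
  have := sub (row_mx z zeta); rewrite /hartogs/= row_mxKl row_mxKr zetaE ltxx.
  by move/(_ lt).
move=> p0 q0 pq; apply/funext => z.
by apply/eqP; rewrite eq_le !le ?pq.
Qed.

End fock_translations.

Theorem theorem3p4 (R : realType) (n m : nat) (hn : (1 <= n)%N)
    (hm : (1 <= m)%N) (mu : R) (hmu : 0 < mu) (p : 'rV[R[i]]_n -> R)
    (p_admissible : admissible [set: 'rV[R[i]]_n] p)
    (pm_admissible : admissible [set: 'rV[R[i]]_n] (fun z => p z ^+ m))
    (Dp_domain : is_domain (hartogs m p))
    (Dp_RKHS : is_RKHS (hartogs m p) (fun=> 1)) :
  [/\ (forall v : 'rV[R[i]]_n, automorphism (hartogs m p) (phi mu v)) <->
        (exists2 c : R, 0 < c &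
           forall z : 'rV[R[i]]_n, p z = c * expR (- mu * hnormsq z)),
      (forall v : 'rV[R[i]]_n,
         automorphism (fock_bargmann_hartogs n m mu) (phi mu v)) &
      (forall v : 'rV[R[i]]_n, automorphism (hartogs m p) (phi mu v)) <->
        (exists2 c : R, 0 < c &
           hartogs m (fun z => c * p z) = fock_bargmann_hartogs n m mu)].
Proof.
have p0 z : 0 < p z by case: p_admissible => -[_ +] _ _; exact.
pose j : 'I_m := Ordinal hm.
have auto_iff : (forall v : 'rV[R[i]]_n,
    automorphism (hartogs m p) (phi mu v)) <->
    (exists2 c : R, 0 < c &
      forall z : 'rV[R[i]]_n, p z = c * expR (- mu * hnormsq z)).
  split=> [autp|[c c0 pE] v].
    exists (p 0) => //; apply: (weight_gaussian mu p j p0) => v.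
    by have [g []] := autp v.
  rewrite (_ : p = fun z => c * expR (- mu * hnormsq z)); last exact/funext.
  by apply: automorphism_phi => w; exact: phi_hartogs_gaussian.
split=> //.
  move=> v; rewrite (_ : fock_bargmann_hartogs n m mu =
      hartogs m (fun z => 1 * expR (- mu * hnormsq z))).
    by apply: automorphism_phi => w; exact: phi_hartogs_gaussian.
  by congr hartogs; apply/funext => z; rewrite mul1r.
apply: (iff_trans auto_iff); split=> -[c c0].
  move=> pE; exists c^-1; first by rewrite invr_gt0.
  by congr hartogs; apply/funext => z; rewrite pE mulKf ?gt_eqF.
move=> eqD; exists c^-1; first by rewrite invr_gt0.
move=> z; apply: (canRL (mulKf _)); first by rewrite gt_eqF.
have cpE : (fun z => c * p z) = fock_weight mu.
  apply: (hartogs_inj _ _ j) eqD => w; first exact: mulr_gt0.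
  exact: expR_gt0.
exact: (congr1 (fun q => q z) cpE).
Qed.
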